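(* Let $n,k\ge 1$ be integers. For a finite set $Z\subset B^n$ and for any $x\in B^n\setminus Z$ let $Z_x=Z\cup\{x\}$, let $f_{Z,x}:Z_x\to\mathbb{R}$ be the function equal to $0$ on $Z$ and to $1$ at $x$, and let $\tilde f_{Z,x}:B^n\to\mathbb{R}$ be any $C^k$-extension of $f_{Z,x}$ to $B^n$ (a $k$ times continuously differentiable function on $B^n$ whose restriction to $Z_x$ is $f_{Z,x}$). Then for each $d=0,\dots,k-1$, $$M_{d+1}(\tilde f_{Z,x})\ge\frac{(d+1)!}{R_d(Z)+1}.$$
   Context: $B^n$ is the closed unit ball centered at the origin in $\mathbb{R}^n$. For a $C^k$ function $g$ on $B^n$ and $0\le l\le k$, $M_l(g)=\max_{B^n}\|d^lg\|$, where $\|d^lg\|$ at a point is the sum of the absolute values of all partial derivatives of $g$ of order $l$, i.e. $\sum_{i_1,\dots,i_l=1}^n|\partial_{i_1}\cdots\partial_{i_l}g|$ (for $l=0$ it is $|g|$). Remez constant: for $Z\subset B^n$ and an integer $d\ge 0$, $R_d(Z)\in[0,\infty]$ is the minimal $K$ such that $\sup_{B^n}|P|\le K\sup_Z|P|$ for every real polynomial $P$ in $n$ variables of degree at most $d$; $R_d(Z)=\infty$ if no finite $K$ works. When $R_d(Z)=\infty$ the right-hand side of the inequality is read as $0$. *)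

(* Defs.v *)
From HB Require Import structures.
From mathcomp Require Import all_boot all_order all_algebra.
From mathcomp Require Import all_classical all_reals all_analysis.
(* Its notations clash with those of MathComp-Analysis. *)
From mathcomp Require Import -(notations) mpoly.

Set Implicit Arguments.
Unset Strict Implicit.
Unset Printing Implicit Defensive.

Import Order.TTheory GRing.Theory Num.Theory.
Import numFieldNormedType.Exports.

Local Open Scope classical_set_scope.
Local Open Scope ring_scope.

(* The ball is Euclidean, whereas the norm MathComp-Analysis puts on 'rV[R]_n
   is the sup norm; both induce the same topology and derivatives. *)
Definition unit_ball (R : realType) (n : nat) : set 'rV[R]_n :=
  [set x | \sum_(i < n) x 0 i ^+ 2 <= 1].

(* d_{i1} (... (d_{il} f)) for s = [:: i1; ...; il].  Only the values of f on
   the ball matter for the value of this function at an interior point; its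
   values elsewhere are never used. *)
Definition partial (R : realType) (n : nat) (f : 'rV[R]_n -> R)
    (s : seq 'I_n) : 'rV[R]_n -> R :=
  foldr (fun i (g : 'rV[R]_n -> R) => 'D_(delta_mx 0 i : 'rV[R]_n) g) f s.

(* C^k on the closed ball, for functions known only there: f is continuous on
   the ball, and its partial derivatives of order at most k exist in the
   interior and extend continuously to the ball.  Every restriction of a C^k
   function on a neighbourhood of the ball satisfies this. *)
Definition Ck_on_ball (R : realType) (n k : nat) (f : 'rV[R]_n -> R) : Prop :=
  {within @unit_ball R n, continuous f} /\
  forall s : seq 'I_n, (size s <= k)%N ->
    ((size s < k)%N -> forall (i : 'I_n) (x : 'rV[R]_n), (@unit_ball R n)° x ->
       derivable (partial f s) x (delta_mx 0 i : 'rV[R]_n)) /\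
    (exists2 g : 'rV[R]_n -> R, {within @unit_ball R n, continuous g} &
       forall x, (@unit_ball R n)° x -> g x = partial f s x).

(* The value of a partial derivative at a point of the closed ball: on the
   boundary it is the value of the continuous extension. *)
Definition partial_ball (R : realType) (n : nat) (f : 'rV[R]_n -> R)
    (s : seq 'I_n) (x : 'rV[R]_n) : R :=
  lim (partial f s y @[y --> within (@unit_ball R n)° (nbhs x)]).

Definition dnorm (R : realType) (n l : nat) (f : 'rV[R]_n -> R)
    (x : 'rV[R]_n) : R :=
  \sum_(s : l.-tuple 'I_n) `|partial_ball f s x|.

(* For f of class C^k and l <= k this supremum is a maximum, the ball being
   compact. *)
Definition M (R : realType) (n l : nat) (f : 'rV[R]_n -> R) : \bar R :=
  ereal_sup [set (dnorm l f x)%:E | x in @unit_ball R n].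

(* sup_A |P|.  The real supremum is adequate for A inside the ball, where P is
   bounded; for A empty it is 0. *)
Definition sup_abs (R : realType) (n : nat) (P : mpoly.mpoly n R)
    (A : set 'rV[R]_n) : R :=
  sup [set `|mpoly.meval (fun i => x 0 i) P| | x in A].

(* [mpoly.msize] is the degree plus one (0 for the zero polynomial).  The
   infimum of the empty set is +oo; otherwise it is attained. *)
Definition remez (R : realType) (n d : nat) (Z : set 'rV[R]_n) : \bar R :=
  ereal_inf [set K%:E | K in [set K : R | 0 <= K /\
    forall P : mpoly.mpoly n R, (mpoly.msize P <= d.+1)%N ->
      sup_abs P (@unit_ball R n) <= K * sup_abs P Z]].

(* Main.v *)
(* Let T be the Taylor polynomial of f at 0 of degree d and m = M_{d+1}(f).
   Taylor's formula along the rays t |-> t y, together with |y_i| <= 1, gives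
   |f - T| <= m / (d+1)! on the ball.  Hence |T| <= m / (d+1)! on Z and
   |T(x)| >= 1 - m / (d+1)!, so that every K admissible in the definition of
   R_d(Z) satisfies 1 - m / (d+1)! <= K m / (d+1)!, i.e. (d+1)! <= m (K + 1).
   The chain rule along rays comes from the continuity of the partial
   derivatives, one coordinate at a time, by the mean value theorem; only
   continuity of f is used at the end of a ray on the unit sphere. *)
Require Import Defs.
From HB Require Import structures.
From mathcomp Require Import all_boot all_order all_algebra.
From mathcomp Require Import all_classical all_reals all_analysis.
From mathcomp Require Import -(notations) mpoly.
From mathcomp Require Import ring.

Set Implicit Arguments.
Unset Strict Implicit.
Unset Printing Implicit Defensive.

Import Order.TTheory GRing.Theory Num.Theory.
Import numFieldNormedType.Exports.

Local Open Scope classical_set_scope.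
Local Open Scope ring_scope.

(** * Derivatives along lines and the chain rule, one coordinate at a time *)

Lemma is_derive_line (R : realType) (V : normedModType R) (g : V -> R)
    (a v : V) (t l : R) :
  is_derive (a + t *: v) v g l -> is_derive t 1 (fun u => g (a + u *: v)) l.
Proof.
move=> [dg <-].
suff E : (fun h => h^-1 *: (((fun u => g (a + u *: v)) \o shift t) (h *: 1) -
                            g (a + t *: v))) =
         (fun h => h^-1 *: ((g \o shift (a + t *: v)) (h *: v) -
                            g (a + t *: v))).
  by apply: DeriveDef; rewrite /derivable /derive E.
apply/funext => h /=.
by rewrite [h *: 1]mulr1 scalerDl addrCA.
Qed.

(** The length [k] may have either sign, since it will be an increment [h * c] with [h] tending to 0
    from both sides. *)
Lemma MVT_line (R : realType) (V : normedModType R) (g : V -> R)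
    (a v : V) (k : R) :
  (forall u : R, `|u| <= `|k| -> derivable g (a + u *: v) v) ->
  exists2 u : R, `|u| <= `|k| & g (a + k *: v) - g a = k * 'D_v g (a + u *: v).
Proof.
move=> dg.
pose gl u := g (a + u *: v).
have dgl (u : R) : `|u| <= `|k| -> is_derive u 1 gl ('D_v g (a + u *: v)).
  by move=> /dg/derivableP; exact: is_derive_line.
have gl0 : gl 0 = g a by rewrite /gl scale0r addr0.
rewrite -[g (a + k *: v)]/(gl k) -gl0.
have [k0|k0|->] := ltgtP k 0.
- have uk (u : R) : u \in `[k, 0] -> `|u| <= `|k|.
    by rewrite in_itv/= => /andP[? ?]; rewrite !ler0_norm ?lerN2// ltW.
  have [||u ku E] := @MVT _ gl (fun u => 'D_v g (a + u *: v)) _ _ k0.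
  + by move=> u ku; apply/dgl/uk; apply: subset_itv_oo_cc ku.
  + by apply: derivable_within_continuous => u /uk/dgl[].
  exists u; first by apply/uk; apply: subset_itv_oo_cc ku.
  by rewrite -opprB E; ring.
- have uk (u : R) : u \in `[0, k] -> `|u| <= `|k|.
    by rewrite in_itv/= => /andP[? ?]; rewrite !ger0_norm// ltW.
  have [||u ku E] := @MVT _ gl (fun u => 'D_v g (a + u *: v)) _ _ k0.
  + by move=> u ku; apply/dgl/uk; apply: subset_itv_oo_cc ku.
  + by apply: derivable_within_continuous => u /uk/dgl[].
  exists u; first by apply/uk; apply: subset_itv_oo_cc ku.
  by rewrite E; ring.
- by exists 0 => //; rewrite subrr mul0r.
Qed.

(** The increment of [g] is split at [h *: v + z]. The first part gives ['D_v g z]; by the mean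
    value theorem the second is [h * c] times ['D_e g] at a point that tends to [z], where ['D_e g]
    is continuous. *)
Lemma is_deriveDv (R : realType) (V : normedModType R) (g : V -> R)
    (z v e : V) (c l : R) :
  is_derive z v g l -> (\forall w \near z, derivable g w e) ->
  {for z, continuous ('D_e g)} ->
  is_derive z (v + c *: e) g (l + c * 'D_e g z).
Proof.
move=> [dg <-] dge ce.
suff H : (fun h => h^-1 *: ((g \o shift z) (h *: (v + c *: e)) - g z)) @ 0^'
   --> 'D_v g z + c * 'D_e g z.
  by apply: DeriveDef; [apply/cvg_ex; eexists; exact: H|exact: cvg_lim].
have -> : (fun h => h^-1 *: ((g \o shift z) (h *: (v + c *: e)) - g z)) =
  (fun h => h^-1 *: ((g \o shift z) (h *: v) - g z)) +
  (fun h => h^-1 *: (g (h *: v + z + (h * c) *: e) - g (h *: v + z))).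
  apply/funext => h; rewrite /= fctE -scalerDr; congr (_ *: _).
  by rewrite [RHS]addrC addrA subrK scalerDr scalerA addrAC.
apply: cvgD; first exact: dg.
apply/cvgrPdist_le => /= eps eps0.
(* The [+ 1] keeps the divisor positive when [c] is 0. *)
have e1 : 0 < eps / (`|c| + 1) by rewrite divr_gt0// ltr_wpDl.
have [r /= r0 rP] : nbhs_ball z (fun w => derivable g w e /\
    `|'D_e g z - 'D_e g w| <= eps / (`|c| + 1)).
  apply/nbhs_ballP; near=> w; split; first by near: w.
  by near: w; move/cvgrPdist_le : ce; exact.
have D0 : 0 < `|v| + `|c| * `|e| + 1 by rewrite ltr_wpDl// addr_ge0// mulr_ge0.
near=> h.
(* The points met below are [h *: v + z + u *: e] with [u] at most [h * c] in absolute value; their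
   distance to [z] is at most [|h| (|v| + |c| |e|)]. *)
have hr : `|h| * (`|v| + `|c| * `|e| + 1) < r.
  rewrite -ltr_pdivlMr//; near: h.
  apply: dnbhs0_lt; exact: divr_gt0.
have h0 : h != 0 by near: h; exact: nbhs_dnbhs_neq.
have near_z (u : R) : `|u| <= `|h * c| -> ball z r (h *: v + z + u *: e).
  move=> uh.
  rewrite -ball_normE /= [h *: v + z]addrC -addrA opprD addNKr normrN.
  apply: le_lt_trans hr; apply: (le_trans (ler_normD _ _)).
  rewrite !normrZ !mulrDr mulr1 mulrA -addrA lerD2l.
  by rewrite (le_trans (ler_wpM2r (normr_ge0 e) uh))// normrM lerDl.
have [|u uh ->] := @MVT_line _ _ g (h *: v + z) e (h * c).
  by move=> u /near_z/rP[].
rewrite [X in _ - X](_ : _ = c * 'D_e g (h *: v + z + u *: e)); last first.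
  by rewrite /GRing.scale /= !mulrA mulVf// mul1r.
rewrite -mulrBr normrM.
have := (rP _ (near_z u uh)).2.
rewrite ler_pdivlMr ?ltr_wpDl//; apply: le_trans.
by rewrite mulrC ler_wpM2l// lerDl.
Unshelve. all: by end_near. Qed.

Lemma is_derive_coord (R : realType) (n : nat) (g : 'rV[R]_n -> R)
    (z y : 'rV[R]_n) :
  (forall i, \forall w \near z, derivable g w (delta_mx 0 i : 'rV[R]_n)) ->
  (forall i, {for z, continuous ('D_(delta_mx 0 i : 'rV[R]_n) g)}) ->
  is_derive z y g (\sum_(i < n) y 0 i * 'D_(delta_mx 0 i : 'rV[R]_n) g z).
Proof.
move=> dg cg; rewrite {1}(row_sum_delta y).
elim/big_rec2 : _ => [|i l v _ IH]; first exact: is_derive0.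
by rewrite addrC [X in is_derive _ _ _ X]addrC; exact: is_deriveDv.
Qed.

(** * The unit ball and the partial derivatives in its interior *)

Lemma interior_unit_ball_scale (R : realType) (n : nat) (y : 'rV[R]_n) (t : R) :
  unit_ball y -> 0 <= t -> t < 1 -> (@unit_ball R n)° (t *: y).
Proof.
rewrite /unit_ball/= => yB t0 t1.
pose q (z : 'rV[R]_n) := \sum_(i < n) z 0 i ^+ 2.
have cq : continuous q.
  rewrite /q; apply: continuous_big => [|i _ z]; first exact: add_continuous.
  apply: (@continuous_comp _ _ _ (fun w : 'rV[R]_n => w 0 i) (fun u => u ^+ 2)).
    exact: coord_continuous.
  exact: exprn_continuous.
(* The open Euclidean ball is open for the sup norm because [q] is continuous; it contains [t *: y]
   because [q (t *: y)] is at most [t ^+ 2]. *)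
have oq : open [set z | q z < 1].
  apply: (@open_comp _ _ q [set u : R | u < 1]); last exact: open_lt.
  by move=> z _; exact: cq.
rewrite /interior /=; apply: (@filterS _ _ _ [set z | q z < 1]).
  by move=> z /= /ltW.
apply: open_nbhs_nbhs; split => //=.
rewrite /q (eq_bigr (fun i => t ^+ 2 * y 0 i ^+ 2)); last first.
  by move=> i _; rewrite mxE exprMn.
rewrite -mulr_sumr; apply: (@le_lt_trans _ _ (t ^+ 2)).
  by rewrite ler_piMr// exprn_ge0.
by rewrite expr_lt1.
Qed.

Lemma unit_ball_coord (R : realType) (n : nat) (y : 'rV[R]_n) (i : 'I_n) :
  unit_ball y -> `|y 0 i| <= 1.
Proof.
rewrite /unit_ball/= => yB.
rewrite -(@expr_le1 _ 2)// real_normK ?num_real//; apply: le_trans yB.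
by rewrite (bigD1 i)//= lerDl sumr_ge0// => j _; exact: sqr_ge0.
Qed.

(** Near [z] the partial derivative coincides with its continuous extension to the ball, the
    interior being open. *)
Lemma partial_continuous (R : realType) (n k : nat) (f : 'rV[R]_n -> R)
    (s : seq 'I_n) (z : 'rV[R]_n) :
  Ck_on_ball k f -> (size s <= k)%N -> (@unit_ball R n)° z ->
  {for z, continuous (partial f s)}.
Proof.
move=> [_ /(_ s)] H sk zB; have [_ [g cg gE]] := H sk.
have oB := open_interior (@unit_ball R n).
rewrite /continuous_at /prop_for.
apply: (@cvg_trans _ (g x @[x --> z])); last first.
  rewrite -gE//.
  have := continuous_subspaceW (@interior_subset _ (@unit_ball R n)) cg.
  by rewrite continuous_open_subspace// => /(_ z); apply; rewrite inE.
apply: (@near_eq_cvg _ _ (nbhs z)); near=> w; apply: gE; near: w.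
by apply: open_nbhs_nbhs; split.
Unshelve. all: by end_near. Qed.

Lemma partial_ball_interior (R : realType) (n k : nat) (f : 'rV[R]_n -> R)
    (s : seq 'I_n) (z : 'rV[R]_n) :
  Ck_on_ball k f -> (size s <= k)%N -> (@unit_ball R n)° z ->
  partial_ball f s z = partial f s z.
Proof.
move=> fCk sk zB; rewrite /partial_ball within_interior; last first.
  by rewrite (interior_id _).1//; exact: open_interior.
by apply: cvg_lim => //; exact: partial_continuous fCk sk zB.
Qed.

Lemma is_derive_partial (R : realType) (n k : nat) (f : 'rV[R]_n -> R)
    (s : seq 'I_n) (z y : 'rV[R]_n) :
  Ck_on_ball k f -> (size s < k)%N -> (@unit_ball R n)° z ->
  is_derive z y (partial f s) (\sum_(i < n) y 0 i * partial f (i :: s) z).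
Proof.
move=> fCk sk zB; apply: is_derive_coord => i; last first.
  exact: (@partial_continuous _ _ _ _ (i :: s) _ fCk).
have : nbhs z (@unit_ball R n)°.
  by apply: open_nbhs_nbhs; split => //; exact: open_interior.
apply: filterS => w wB.
by case: fCk => _ /(_ s (ltnW sk))[/(_ sk i w wB)].
Qed.

(** * Derivatives along rays from the origin *)

(** Differentiating a term of order [l] puts one new index in front of its tuple; this regroups the
    sum of order [l.+1] accordingly. *)
Lemma sum_tupleS (V : nmodType) (T : finType) (l : nat)
    (F : l.+1.-tuple T -> V) :
  \sum_s F s = \sum_(s : l.-tuple T) \sum_(i : T) F [tuple of i :: s].
Proof.
rewrite pair_big /=.
rewrite (reindex (fun p : l.-tuple T * T => [tuple of p.2 :: p.1]))//=.
exists (fun s : l.+1.-tuple T => ([tuple of behead s], thead s)) => [[s i] _|s _] /=.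
  by congr pair; apply/val_inj.
by rewrite [RHS]tuple_eta.
Qed.

(* For f of class C^l this is the l-th derivative of u |-> f (u y) at t. *)
Definition radial (R : realType) (n : nat) (f : 'rV[R]_n -> R)
    (y : 'rV[R]_n) (l : nat) (t : R) : R :=
  \sum_(s : l.-tuple 'I_n) (\prod_(i <- s) y 0 i) * partial f s (t *: y).

(** Each summand is differentiated in the direction [y], and the new factor [y 0 i] joins the
    product of coordinates. *)
Lemma is_derive_radial (R : realType) (n k : nat) (f : 'rV[R]_n -> R)
    (y : 'rV[R]_n) (l : nat) (t : R) :
  Ck_on_ball k f -> (l < k)%N -> (@unit_ball R n)° (t *: y) ->
  is_derive t 1 (radial f y l) (radial f y l.+1 t).
Proof.
move=> fCk lk tyB.
have -> : radial f y l = \sum_(s : l.-tuple 'I_n)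
    (fun u => (\prod_(i <- s) y 0 i) *: partial f s (u *: y)).
  by apply/funext => u; rewrite fct_sumE.
rewrite /radial sum_tupleS.
elim/big_ind2 : _ => [|f1 d1 f2 d2 h1 h2|s _].
- exact: is_derive_cst.
- exact: is_deriveD.
rewrite [X in is_derive _ _ _ X](_ : _ = (\prod_(i <- s) y 0 i) *:
    \sum_(i < n) y 0 i * partial f (i :: s) (t *: y)); last first.
  rewrite scaler_sumr; apply: eq_bigr => i _.
  by rewrite big_cons /GRing.scale/= mulrCA mulrA.
apply: is_deriveZ.
have H : is_derive (0 + t *: y) y (partial f s)
    (\sum_(i < n) y 0 i * partial f (i :: s) (t *: y)).
  by rewrite add0r; apply: is_derive_partial fCk _ tyB; rewrite size_tuple.
have := is_derive_line H.
by congr is_derive; apply/funext => u; rewrite add0r.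
Qed.

Lemma radial_le (R : realType) (n k : nat) (f : 'rV[R]_n -> R)
    (y : 'rV[R]_n) (l : nat) (t : R) :
  Ck_on_ball k f -> (l <= k)%N -> unit_ball y -> (@unit_ball R n)° (t *: y) ->
  `|radial f y l t| <= dnorm l f (t *: y).
Proof.
move=> fCk lk yB tyB; apply: (le_trans (ler_norm_sum _ _ _)).
apply: ler_sum => s _.
rewrite (partial_ball_interior fCk) ?size_tuple// normrM ler_piMl//.
rewrite normr_prod; apply: prodr_ile1 => i _.
by rewrite normr_ge0 unit_ball_coord.
Qed.

(** * Taylor's bound in one variable *)

(** The difference [p - g] is nondecreasing. At [b] itself only continuity is assumed, to allow for
    a ray that ends on the unit sphere. *)
Lemma le_of_derive_le (R : realType) (b : R) (g dg p dp : R -> R) :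
  {within `[0, b], continuous g} -> {within `[0, b], continuous p} ->
  (forall t, 0 <= t -> t < b -> is_derive t 1 g (dg t)) ->
  (forall t, 0 <= t -> t < b -> is_derive t 1 p (dp t)) ->
  g 0 = p 0 -> (forall t, 0 <= t -> t < b -> dg t <= dp t) ->
  forall t, 0 <= t -> t <= b -> g t <= p t.
Proof.
move=> cg cp dgP dpP gp0 le t t0 tb.
suff : (p - g) 0 <= (p - g) t by rewrite !fctE gp0 subrr subr_ge0.
apply: (@ger0_derive1_le_cc _ (p - g) 0 b) => //.
- move=> u; rewrite in_itv/= => /andP[/ltW u0 ub].
  by apply: derivableB; [case: (dpP u u0 ub)|case: (dgP u u0 ub)].
- move=> u; rewrite in_itv/= => /andP[/ltW u0 ub].
  have [dp1 dp2] := dpP u u0 ub; have [dg1 dg2] := dgP u u0 ub.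
  by rewrite derive1E deriveB// subr_ge0 dp2 dg2; exact: le.
- by move=> u; apply: cvgB; [exact: cp|exact: cg].
- by rewrite in_itv/= lexx (le_trans t0).
- by rewrite in_itv/= t0.
Qed.

(** Here [d] counts the terms, so the degree is below [d]. The [c l] stand for the derivatives at 0,
    so that differentiation is a shift of [c]. *)
Definition taylor_poly (R : realType) (c : nat -> R) (d : nat) (t : R) : R :=
  \sum_(l < d) c l * t ^+ l / l`!%:R.

Lemma is_derive_taylor_poly (R : realType) (c : nat -> R) (d : nat) (t : R) :
  is_derive t 1 (taylor_poly c d.+1) (taylor_poly (fun l => c l.+1) d t).
Proof.
have -> : taylor_poly c d.+1 = cst (c 0%N) +
    \sum_(l < d) (c l.+1 / l.+1`!%:R) *: ((@id R) ^+ l.+1).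
  apply/funext => u; rewrite /taylor_poly big_ord_recl fctE fct_sumE.
  rewrite expr0 fact0 mulr1 divr1; congr (_ + _); apply: eq_bigr => l _.
  by rewrite fctE; exact: mulrAC.
rewrite -[X in is_derive _ _ _ X]add0r; apply: is_deriveD.
apply: is_derive_sum => l; apply: is_derive_eq.
rewrite /GRing.scale/= mulr1 factS natrM.
have l1 : (l.+1%:R : R) != 0 by rewrite pnatr_eq0.
have l2 : (l`!%:R : R) != 0 by rewrite pnatr_eq0 -lt0n fact_gt0.
by field; rewrite l2 addrC natr1 l1.
Qed.

Lemma taylor_poly0 (R : realType) (c : nat -> R) (d : nat) :
  taylor_poly c d.+1 0 = c 0%N.
Proof.
rewrite /taylor_poly big_ord_recl expr0 fact0 mulr1 divr1 big1 ?addr0// => l _.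
by rewrite expr0n mulr0 mul0r.
Qed.

Lemma continuous_taylor_poly (R : realType) (c : nat -> R) (d : nat) (A : set R) :
  {within A, continuous (taylor_poly c d.+1)}.
Proof.
apply: continuous_subspaceT => w; apply: differentiable_continuous.
by apply/derivable1_diffP; case: (is_derive_taylor_poly c d w).
Qed.

(* The remainder term is absorbed into the polynomial as one more coefficient. *)
Lemma taylor_bound_step (R : realType) (d : nat) (g dg : R -> R)
    (c : nat -> R) (b m : R) :
  {within `[0, b], continuous g} -> g 0 = c 0%N ->
  (forall t, 0 <= t -> t < b -> is_derive t 1 g (dg t)) ->
  (forall t, 0 <= t -> t < b ->
    `|dg t - taylor_poly (fun l => c l.+1) d t| <= m * t ^+ d / d`!%:R) ->
  forall t, 0 <= t -> t <= b ->
    `|g t - taylor_poly c d.+1 t| <= m * t ^+ d.+1 / d.+1`!%:R.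
Proof.
move=> cg gc dgP bd t t0 tb.
pose c' r l := if l == d.+1 then r else c l.
have c'E r u : taylor_poly (c' r) d.+2 u =
    taylor_poly c d.+1 u + r * u ^+ d.+1 / d.+1`!%:R.
  rewrite /taylor_poly big_ord_recr/= /c' eqxx; congr (_ + _).
  by apply: eq_bigr => l _; rewrite ltn_eqF.
have dc'E r u : taylor_poly (fun l => c' r l.+1) d.+1 u =
    taylor_poly (fun l => c l.+1) d u + r * u ^+ d / d`!%:R.
  rewrite /taylor_poly big_ord_recr/= /c' eqxx; congr (_ + _).
  by apply: eq_bigr => l _; rewrite eqSS ltn_eqF.
have cc' r := @continuous_taylor_poly _ (c' r) d.+1 `[0, b].
have dc' r u (_ : 0 <= u) (_ : u < b) := is_derive_taylor_poly (c' r) d.+1 u.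
have c'0 r : g 0 = taylor_poly (c' r) d.+2 0 by rewrite taylor_poly0.
(* The two sides of the absolute value become comparisons of [g] with the polynomials whose extra
   coefficient is [- m] and [m]. *)
rewrite ler_norml lerBlDl lerBrDl -c'E -mulNr -mulNr -c'E; apply/andP; split.
- apply: (le_of_derive_le (cc' _) cg (dc' _) dgP) => // u u0 ub.
  by have := bd u u0 ub; rewrite dc'E ler_norml lerBrDl !mulNr => /andP[].
- apply: (le_of_derive_le cg (cc' _) dgP (dc' _)) => // u u0 ub.
  by have := bd u u0 ub; rewrite dc'E ler_norml lerBlDl => /andP[].
Qed.

(** The bound on [phi d.+1] is integrated [d.+1] times, lowering the order by one each time. *)
Lemma taylor_bound (R : realType) (d : nat) (phi : nat -> R -> R) (b m : R) :
  {within `[0, b], continuous (phi 0%N)} ->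
  (forall l t, (l <= d)%N -> 0 <= t -> t < b ->
     is_derive t 1 (phi l) (phi l.+1 t)) ->
  (forall t, 0 <= t -> t < b -> `|phi d.+1 t| <= m) ->
  forall t, 0 <= t -> t <= b ->
    `|phi 0%N t - taylor_poly (phi ^~ 0) d.+1 t| <= m * t ^+ d.+1 / d.+1`!%:R.
Proof.
move=> c0 dphi bd.
(* The last integration is split off: it alone reaches [b], where continuity is assumed for [phi 0]
   only. *)
apply: (@taylor_bound_step _ d (phi 0%N) (phi 1%N) (phi ^~ 0)) => //.
  by move=> t; exact: dphi.
elim: d phi {c0} dphi bd => [|d IH] phi dphi bd t t0 tb.
  by rewrite /taylor_poly big_ord0 subr0 expr0 mulr1 fact0 divr1; exact: bd.
have td u : 0 <= u -> u <= t -> is_derive u 1 (phi 1%N) (phi 2%N u).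
  by move=> u0 ut; apply: dphi => //; exact: le_lt_trans tb.
(* The interval is now [[0, t]] with [t < b], on which differentiability supplies the continuity. *)
apply: (@taylor_bound_step _ d (phi 1%N) (phi 2%N) (fun l => phi l.+1 0) t) => //.
- apply: derivable_within_continuous => u; rewrite in_itv/= => /andP[u0 ut].
  by case: (td u u0 ut).
- by move=> u u0 /ltW; exact: td.
- move=> u u0 ut; apply: (IH (fun l => phi l.+1)) => //.
  + by move=> l w ld; exact: dphi.
  + exact: lt_trans tb.
Qed.

(** * The Taylor polynomial in [n] variables and its error on the ball *)

(** Ordered tuples replace multi-indices: a monomial occurs once per ordering of its indices, whence
    the weight [1 / l!] instead of the inverse of a multi-index factorial. The terms then match
    those of [radial]. *)
Definition taylor_mpoly (R : realType) (n : nat) (f : 'rV[R]_n -> R) (d : nat) :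
    mpoly.mpoly n R :=
  \sum_(l < d.+1) \sum_(s : l.-tuple 'I_n)
    (partial f s 0 / l`!%:R) *: \prod_(i <- s) mpoly.mpolyX R (mpoly.mnm1 i).

Lemma msize_taylor_mpoly (R : realType) (n : nat) (f : 'rV[R]_n -> R) (d : nat) :
  (mpoly.msize (taylor_mpoly f d) <= d.+1)%N.
Proof.
apply: (leq_trans (mpoly.msize_sum _ _ _)); apply/bigmax_leqP => l _.
apply: (leq_trans (mpoly.msize_sum _ _ _)); apply/bigmax_leqP => s _.
apply: (leq_trans (mpoly.msizeZ_le _ _)).
rewrite mpoly.mprodXE mpoly.msizeX mpoly.mdeg_sum (eq_bigr (fun=> 1%N)).
  by rewrite sum1_size size_tuple; exact: ltn_ord.
by move=> i _; exact: mpoly.mdeg1.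
Qed.

Lemma meval_taylor_mpoly (R : realType) (n : nat) (f : 'rV[R]_n -> R) (d : nat)
    (y : 'rV[R]_n) :
  mpoly.meval (fun i => y 0 i) (taylor_mpoly f d) =
  taylor_poly (fun l => radial f y l 0) d.+1 1.
Proof.
rewrite /taylor_mpoly raddf_sum; apply: eq_bigr => l _.
rewrite raddf_sum expr1n mulr1 /radial mulr_suml; apply: eq_bigr => s _.
rewrite /= mpoly.mevalZ rmorph_prod/= scale0r mulrC mulrA.
by under eq_bigr do rewrite mpoly.mevalXU.
Qed.

Lemma radial0 (R : realType) (n : nat) (f : 'rV[R]_n -> R) (y : 'rV[R]_n)
    (t : R) :
  radial f y 0 t = f (t *: y).
Proof.
rewrite /radial (big_pred1 [tuple]); first by rewrite big_nil mul1r.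
by move=> s; apply/esym/eqP; exact: tuple0.
Qed.

Lemma within_radial0 (R : realType) (n k : nat) (f : 'rV[R]_n -> R)
    (y : 'rV[R]_n) :
  Ck_on_ball k f -> unit_ball y -> {within `[0, 1], continuous (radial f y 0)}.
Proof.
move=> [cf _] yB.
rewrite (_ : radial f y 0 = f \o ( *:%R^~ y)); last first.
  by apply/funext => t; rewrite radial0.
have sB t : t \in `[0, 1] -> unit_ball (t *: y).
  rewrite in_itv/= => /andP[t0 t1]; move: yB; rewrite /unit_ball/=.
  apply: le_trans; apply: ler_sum => i _.
  by rewrite mxE exprMn ler_piMl ?sqr_ge0// expr_le1.
apply/subspace_continuousP => t tI.
move/subspace_continuousP : cf => /(_ _ (sB t tI)) cf.
apply: (@cvg_comp _ _ _ _ _ (within `[0, 1] (nbhs t)) _ _ _ cf) => W.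
move=> /(@scalel_continuous _ _ y t); rewrite nbhs_simpl /= => nW.
apply: (@filterS _ (nbhs t) _ _ _ _ nW) => u uW uI.
by apply: uW; exact: sB.
Qed.

Lemma taylor_ball (R : realType) (n k : nat) (f : 'rV[R]_n -> R) (d : nat)
    (m : R) (y : 'rV[R]_n) :
  Ck_on_ball k f -> (d < k)%N ->
  (forall z, (@unit_ball R n)° z -> dnorm d.+1 f z <= m) -> unit_ball y ->
  `|f y - mpoly.meval (fun i => y 0 i) (taylor_mpoly f d)| <= m / d.+1`!%:R.
Proof.
move=> fCk dk bd yB.
have -> : f y = radial f y 0 1 by rewrite radial0 scale1r.
have := @taylor_bound R d (radial f y) 1 m (within_radial0 fCk yB) _ _ 1.
rewrite expr1n mulr1 meval_taylor_mpoly; apply => //.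
- move=> l t ld t0 t1; apply: (is_derive_radial fCk).
    exact: leq_ltn_trans dk.
  exact: interior_unit_ball_scale.
- move=> t t0 t1; have tB := interior_unit_ball_scale yB t0 t1.
  by apply: le_trans (bd _ tB); exact: radial_le fCk dk yB tB.
Qed.

(** * Passage to the Remez constant *)

(** Monomials are at most 1 in absolute value on the ball. This makes the [sup] in [sup_abs] a true
    upper bound there, whereas on an unbounded set it would default to 0. *)
Lemma meval_bounded (R : realType) (n : nat) (P : mpoly.mpoly n R) :
  has_ubound [set `|mpoly.meval (fun i => x 0 i) P| | x in @unit_ball R n].
Proof.
exists (\sum_(m <- mpoly.msupp P) `|mpoly.mcoeff m P|) => _ [y yB <-].
rewrite mpoly.mevalE; apply: (le_trans (ler_norm_sum _ _ _)).
apply: ler_sum => m _; rewrite normrM ler_piMr// normr_prod.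
apply: prodr_ile1 => i _.
by rewrite normr_ge0 normrX exprn_ile1// unit_ball_coord.
Qed.

Lemma dnorm_ge0 (R : realType) (n l : nat) (f : 'rV[R]_n -> R) (z : 'rV[R]_n) :
  0 <= dnorm l f z.
Proof. exact: sumr_ge0. Qed.

Lemma unit_ball0 (R : realType) (n : nat) : @unit_ball R n 0.
Proof. by rewrite /unit_ball/= big1// => i _; rewrite mxE expr0n. Qed.

(* When remez d Z = +oo the left-hand side is 0, since +oo^-1 = 0 in \bar R. *)
Theorem theorem4p1 (R : realType) (n k : nat) (hn : (1 <= n)%N)
    (hk : (1 <= k)%N) (Z : set 'rV[R]_n) (finZ : finite_set Z)
    (ZB : Z `<=` @unit_ball R n) (x : 'rV[R]_n) (xB : (@unit_ball R n `\` Z) x)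
    (f : 'rV[R]_n -> R) (fCk : Ck_on_ball k f)
    (fZ : forall z, Z z -> f z = 0) (fx : f x = 1)
    (d : nat) (hd : (d < k)%N) :
  ((d.+1`!%:R)%:E / (remez d Z + 1) <= M d.+1 f)%E.
Proof.
have dM z : unit_ball z -> ((dnorm d.+1 f z)%:E <= M d.+1 f)%E.
  by move=> zB; apply: ereal_sup_ubound; exists z.
have M0 : (0 <= M d.+1 f)%E.
  by apply: le_trans (dM 0 (@unit_ball0 R n)); rewrite lee_fin dnorm_ge0.
move: dM M0; case: (M d.+1 f) => [m| |] dM M0 //; last by rewrite leey.
have m0 : 0 <= m by rewrite -lee_fin.
set c : R := d.+1`!%:R.
have c0 : 0 < c by rewrite ltr0n fact_gt0.
pose T := taylor_mpoly f d.
have fT y : unit_ball y -> `|f y - mpoly.meval (fun i => y 0 i) T| <= m / c.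
  apply: (taylor_ball fCk hd) => // z /interior_subset zB.
  by rewrite -lee_fin; exact: dM.
pose admissible (K : R) := 0 <= K /\
  forall P : mpoly.mpoly n R, (mpoly.msize P <= d.+1)%N ->
    sup_abs P (@unit_ball R n) <= K * sup_abs P Z.
have key (K : R) : admissible K -> c <= m * (K + 1).
  move=> [K0 /(_ _ (msize_taylor_mpoly f d)) HK].
  have sZ : sup_abs T Z <= m / c.
    (* For empty [Z] the supremum takes its default value 0. *)
    rewrite /sup_abs; have [->|Z0] := eqVneq Z set0.
      by rewrite image_set0 sup0 divr_ge0// ltW.
    apply: ge_sup; first by move/set0P : Z0 => [z zZ]; eexists; exists z.
    move=> _ [z zZ <-]; have := fT z (ZB _ zZ).
    by rewrite fZ// sub0r normrN.
  have sB : `|mpoly.meval (fun i => x 0 i) T| <= K * (m / c).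
    apply: (le_trans _ (ler_wpM2l K0 sZ)); apply: le_trans HK.
    apply: ub_le_sup; first exact: meval_bounded.
    by exists x => //; case: xB.
  have := fT x xB.1; rewrite fx => tx.
  have : 1 <= (m / c) * (K + 1).
    (* Write 1 as [(1 - T(x)) + T(x)] and bound the two terms by [tx] and [sB]. *)
    rewrite -[leLHS]normr1 -[X in `|X|](subrK (mpoly.meval (fun i => x 0 i) T)).
    rewrite (le_trans (ler_normD _ _))// mulrDr mulr1 addrC lerD//.
    by rewrite [leRHS]mulrC.
  by rewrite mulrAC ler_pdivlMr// mul1r.
(* The infimum is handled through real lower bounds of the admissible constants, which [key]
   provides. *)
have remez_ge (r : R) :
    (forall K, admissible K -> r <= K) -> (r%:E <= remez d Z)%E.
  by move=> H; apply: le_ereal_inf_tmp => _ [K KP <-]; rewrite lee_fin; exact: H.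
have R0 : (0 <= remez d Z)%E by apply: remez_ge => K [].
move: R0 remez_ge; case: (remez d Z) => [r| |] // R0 remez_ge; last first.
  by rewrite invey mule0 lee_fin.
have r0 : 0 <= r by rewrite -lee_fin.
rewrite -EFinD inver gt_eqF ?ltr_wpDl// -EFinM lee_fin ler_pdivrMr ?ltr_wpDl//.
(* If [m = 0], then [key] would give [c <= 0], so no constant is admissible; every real, even
   [r + 1], is then a lower bound, against the finiteness of [remez d Z]. *)
move: m0; rewrite le_eqVlt => /predU1P[m0|m0].
  suff : ((r + 1)%:E <= r%:E)%E by rewrite lee_fin -lerBrDl subrr ler10.
  apply: remez_ge => K /key; rewrite -m0 mul0r => /(lt_le_trans c0).
  by rewrite ltxx.
(* For [m > 0], [key] says that [c / m - 1] is a lower bound of the admissible constants. *)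
have : ((c / m - 1)%:E <= r%:E)%E.
  by apply: remez_ge => K /key; rewrite lerBlDr ler_pdivrMr// mulrC.
by rewrite lee_fin lerBlDr ler_pdivrMr// mulrC.
Qed.
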